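(* Let $k\ge 2$ and let $P,Q$ be distributions over $x=(x_1,\dots,x_k)$ with $x_i\in\{1,\dots,r_i\}$, and assume $P(x_i=t)>0$ for all $i\in[k]$, $t\in[r_i]$. Let $\mathcal{F}=\{\sum_{i=1}^k f_i(x_i)\}$ with $f_i:\{1,\dots,r_i\}\to\mathbb{R}$ arbitrary, and $r=\sum_{i=1}^k r_i$. Then $$\tau(P,Q,\mathcal{F})=\sup_{v\in\mathbb{R}^{r}}\frac{v^\top K_Q v}{v^\top K_P v}\le \frac{k}{\lambda_k(\bar K_P)}\max_{i\in[k],\,t\in[r_i]}\frac{Q(x_i=t)}{P(x_i=t)}$$ (the supremum using the convention $0/0=0$, and the bound interpreted as $+\infty$ if $\lambda_k(\bar K_P)=0$).
   Context: $\tau(P,Q,\mathcal{F})=\sup_{f,g\in\mathcal{F}}\mathbb{E}_Q[(f(x)-g(x))^2]/\mathbb{E}_P[(f(x)-g(x))^2]$ with the convention $0/0=0$. For a distribution $P$, define blocks $P_{ij}\in\mathbb{R}^{r_i\times r_j}$ by $[P_{ij}]_{a,b}=P(x_i=a,x_j=b)$ for $i\ne j$, and $P_{ii}\in\mathbb{R}^{r_i\times r_i}$ diagonal with $[P_{ii}]_{a,a}=P(x_i=a)$. Let $K_P\in\mathbb{R}^{r\times r}$ be the block matrix with $(i,j)$ block $P_{ij}$, and $\bar K_P=\mathrm{diag}(K_P)^{-1/2}K_P\,\mathrm{diag}(K_P)^{-1/2}$, where $\mathrm{diag}(K_P)$ keeps only the diagonal entries of $K_P$; $K_Q$ is defined analogously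 from $Q$. $\lambda_k(M)$ denotes the $k$-th smallest eigenvalue of a symmetric matrix $M$. *)

(* Defs.v *)
From HB Require Import structures.
From mathcomp Require Import all_boot all_order all_algebra.
From mathcomp Require Import boolp classical_sets reals constructive_ereal ereal.
Set Implicit Arguments. Unset Strict Implicit. Unset Printing Implicit Defensive.
Import Order.TTheory GRing.Theory Num.Theory.
Local Open Scope ring_scope.

Section Defs.
Variable R : realType.
Variable k : nat.
Variable r : 'I_k -> nat.

Definition pspace := {dffun forall i : 'I_k, 'I_(r i)}.

Definition is_distr (P : pspace -> R) :=
  (forall x, 0 <= P x) /\ \sum_(x : pspace) P x = 1.

Definition expect (P : pspace -> R) (h : pspace -> R) : R := \sum_(x : pspace) P x * h x.

Definition marg (P : pspace -> R) (i : 'I_k) (a : 'I_(r i)) : R :=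
  \sum_(x : pspace | x i == a) P x.
Definition joint (P : pspace -> R) (i j : 'I_k) (a : 'I_(r i)) (b : 'I_(r j)) : R :=
  \sum_(x : pspace | (x i == a) && (x j == b)) P x.

Definition addfun (f : forall i : 'I_k, 'I_(r i) -> R) (x : pspace) : R :=
  \sum_(i < k) f i (x i).

Definition ratioE (a b : R) : \bar R :=
  if b == 0 then (if a == 0 then 0%E else +oo%E) else (a / b)%:E.

Definition tau (P Q : pspace -> R) : \bar R :=
  ereal_sup [set y | exists f g : forall i : 'I_k, 'I_(r i) -> R,
    y = ratioE (expect Q (fun x => (addfun f x - addfun g x) ^+ 2))
               (expect P (fun x => (addfun f x - addfun g x) ^+ 2))].

Notation rtot := (\sum_(i < k) r i)%N.

Definition Kblock (P : pspace -> R) (i j : 'I_k) : 'M[R]_(r i, r j) :=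
  \matrix_(a < r i, b < r j) (if i == j then (if val a == val b then marg P (i:=i) a else 0)
                  else joint P (i:=i) (j:=j) a b).

Definition KP (P : pspace -> R) : 'M[R]_rtot := mxblock (Kblock P).

Definition normK n (K : 'M[R]_n) : 'M[R]_n :=
  let D := diag_mx (\row_a (Num.sqrt (K a a))^-1) in D *m K *m D.

(* eigenvalues with algebraic multiplicity, sorted increasingly:
   the sorted list of roots of the characteristic polynomial when it splits *)
Definition eigvals n (M : 'M[R]_n) : seq R :=
  xget [::] (fun s : seq R => sorted <=%R s /\
                char_poly M = \prod_(c <- s) ('X - c%:P)).

Definition lambda_k n (kk : nat) (M : 'M[R]_n) : R := nth 0 (eigvals M) kk.-1.

Definition quadf n (M : 'M[R]_n) (v : 'cV[R]_n) : R := (v^T *m M *m v) 0 0.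

End Defs.

(* Main.v *)
Require Import Defs.
From HB Require Import structures.
From mathcomp Require Import all_boot all_order all_algebra.
From mathcomp Require Import boolp classical_sets reals constructive_ereal ereal.
From mathcomp Require Import spectral complex ring.
Import Order.TTheory GRing.Theory Num.Theory.
Local Open Scope ring_scope.

(** The matrix [KP P] is the Gram matrix, in [L^2(P)], of the indicators of the
    events [x_i = t], so [v^T K_P v = E_P[(sum_i v_i(x_i))^2]]; this gives the
    formula for [tau].  The vectors that are constant on each block, with block
    constants summing to [0], represent the zero function and form a space of
    dimension [k-1] in the kernel of both [K_P] and [K_Q].  If [lambda_k] of the
    normalized matrix is not [0], this space is the whole kernel of [K_P], so
    the component [u] of [diag(K_P)^{1/2} v] orthogonal to the kernel of the
    normalized matrix satisfies [lambda_k |u|^2 <= v^T K_P v], while passing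
    from [v] to [diag(K_P)^{-1/2} u] does not change the [K_Q]-form.  By
    Cauchy-Schwarz, [K_Q <= k diag(K_Q)], and [diag(K_Q)] is compared with
    [diag(K_P)] entrywise. *)

(** * Spectra of real symmetric matrices *)

Lemma rank_diag_mx (F : fieldType) n (d : 'rV[F]_n) :
  \rank (diag_mx d) = (\sum_i (d 0 i != 0)%R)%N.
Proof.
elim: n d => [|n IHn] d; first by rewrite big_ord0 thinmx0 mxrank0.
rewrite -(@hsubmxK _ 1 1 n d) (@diag_mx_row _ n 1) (@rank_diag_block_mx _ 1 1 n n) IHn.
rewrite (@big_split_ord _ _ _ 1 n) big_ord1 /=.
congr (_ + _)%N; last by apply: eq_bigr => i _; rewrite (@row_mxEr _ 1 1 n).
rewrite (@row_mxEl _ 1 1 n) rank_rV; congr (nat_of_bool (negb _)).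
apply/eqP/eqP => [/matrixP/(_ 0 0)|d0]; first by rewrite !mxE eqxx mulr1n.
by apply/matrixP => i j; rewrite !ord1 !mxE eqxx mulr1n -[RHS]d0 mxE.
Qed.

Lemma char_poly_similar (F : fieldType) n (P A B : 'M[F]_n) :
  P \in unitmx -> P *m A = B *m P -> char_poly A = char_poly B.
Proof.
move=> Pu PA.
have detP0 : \det (map_mx polyC P) != 0.
  by rewrite det_map_mx polyC_eq0 -unitfE -unitmxE.
apply: (mulfI detP0); rewrite [RHS]mulrC -!det_mulmx; congr (\det _).
by rewrite !mulmxBr !mulmxBl -!map_mxM PA scalar_mxC.
Qed.

Lemma quad_diag (F : comNzRingType) n (d y : 'rV[F]_n) (w : 'cV[F]_n) :
  (y *m diag_mx d *m w) 0 0 = \sum_i d 0 i * (y 0 i * w i 0).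
Proof.
rewrite mxE; apply: eq_bigr => i _; rewrite mul_mx_diag mxE.
by rewrite [y 0 i * d 0 i]mulrC mulrA.
Qed.

(* The [y i] are the squared moduli of the coordinates of [z] in a unitary
   eigenbasis over [R[i]]. *)
Lemma sym_spectral (R : rcfType) n (M : 'M[R]_n) : M^T = M ->
  exists e : 'rV[R]_n,
  [/\ char_poly M = \prod_i ('X - (e 0 i)%:P),
      \rank M = (\sum_i (e 0 i != 0)%R)%N
    & forall z : 'rV[R]_n, exists2 y : 'I_n -> R, (forall i, 0 <= y i) &
      forall j, (z *m M ^+ j *m z^T) 0 0 = \sum_i e 0 i ^+ j * y i].
Proof.
move=> Msym.
pose c := real_complex R.
pose M' := map_mx c M; pose U := spectralmx M'; pose d := spectral_diag M'.
have c_real x : c x \is Num.real by rewrite complex_real.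
have M'real : M' \is a realmx by apply/mxOverP => i j; rewrite mxE.
have M'sym : M' \is symmetricmx.
  by apply/is_hermitianmxP; rewrite expr0 scale1r map_mx_id // map_trmx Msym.
have M'herm := realsym_hermsym M'sym M'real.
have Uu : U \in unitmx := spectral_unit M'.
have M'E : M' = invmx U *m diag_mx d *m U.
  by apply/orthomx_spectralP/hermitian_normalmx.
have /mxOverP d_real := hermitian_spectral_diag_real M'herm.
pose e : 'rV[R]_n := map_mx (@complex.Re R) d.
have de : d = map_mx c e.
  apply/rowP => i; rewrite !mxE.
  exact/esym/RRe_real/d_real.
have UM : U *m M' = diag_mx d *m U by rewrite M'E !mulmxA mulmxV // mul1mx.
exists e; split.
- apply: (map_poly_inj c).
  rewrite map_char_poly (char_poly_similar _ _ U M' (diag_mx d)) //.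
  rewrite char_poly_trig ?diag_mx_is_trig //.
  rewrite rmorph_prod /=; apply: eq_bigr => i _.
  by rewrite map_polyXsubC /= de !mxE eqxx mulr1n.
- rewrite -(mxrank_map c) -/M' M'E mxrankMfree ?row_free_unit //.
  rewrite eqmxMfull ?row_full_unit ?unitmx_inv //.
  rewrite rank_diag_mx; apply: eq_bigr => i _.
  by rewrite de mxE fmorph_eq0.
move=> z; pose z' := map_mx c z; pose y := z' *m invmx U.
have UV : invmx U = map_mx Num.conj U^T.
  by rewrite invmx_unitary ?spectral_unitarymx.
(* [z] is real and [U] unitary, so [U *m z'^T] lists the conjugates of the entries of [y]. *)
have yE i : y 0 i * (U *m z'^T) i 0 = `|y 0 i| ^+ 2.
  rewrite normCK; congr (_ * _); rewrite /y UV !mxE rmorph_sum.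
  apply: eq_bigr => s _; rewrite !mxE rmorphM /= conjCK mulrC; congr (_ * _).
  by rewrite -[LHS]conj_Creal.
exists (fun i => complex.Re (`|y 0 i| ^+ 2)) => [i|j].
  by rewrite -lecR RRe_real ?realX ?normr_real // exprn_ge0.
apply: (@complexI R).
have M'X : map_mx c (M ^+ j) = M' ^+ j.
  elim: j => [|j IH]; first by rewrite !expr0 map_mx1.
  by rewrite !exprSr map_mxM IH.
have -> : real_complex R ((z *m M ^+ j *m z^T) 0 0) =
   (z' *m M' ^+ j *m z'^T) 0 0.
  rewrite -/c /z' map_trmx -M'X -!map_mxM. by rewrite [RHS]mxE.
have UMj : U *m M' ^+ j = diag_mx (map_mx (fun x => x ^+ j) d) *m U.
  elim: j {M'X} => [|j IH].
    rewrite !expr0 mulmx1 (_ : diag_mx _ = 1%:M) ?mul1mx //.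
    by apply/matrixP => a b; rewrite !mxE.
  rewrite exprSr mulmxA IH -mulmxA UM mulmxA; congr (_ *m _).
  by rewrite mulmx_diag; congr diag_mx; apply/rowP => a; rewrite !mxE exprSr.
have zE : z' = y *m U by rewrite /y mulmxKV.
rewrite {1}zE -[y *m U *m _]mulmxA UMj mulmxA -[_ *m U *m _]mulmxA.
rewrite quad_diag rmorph_sum; apply: eq_bigr => i _.
rewrite yE mxE de mxE rmorphM rmorphXn; congr (_ * _).
by symmetry; apply: RRe_real; rewrite realX ?normr_real.
Qed.

(** [eigvals] is selected by [xget] with a default; diagonalization provides an admissible list, so
    the selected one meets its specification. *)
Lemma sym_eigvalsP (R : realType) n (M : 'M[R]_n) : M^T = M ->
  sorted <=%R (eigvals M) /\ char_poly M = \prod_(c <- eigvals M) ('X - c%:P).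
Proof.
move=> /sym_spectral[e [charM _ _]]; rewrite /eigvals.
apply: (@xgetPex _ _ (fun s => sorted _ s /\ _)).
exists (sort <=%R [seq e 0 i | i <- enum 'I_n]); split.
  exact: sort_le_sorted.
rewrite charM (perm_big _ (permEl (perm_sort _ _))) /=.
by rewrite big_map big_enum.
Qed.

Lemma quad_self_ge0 (R : realDomainType) n (u : 'rV[R]_n) : 0 <= (u *m u^T) 0 0.
Proof. by rewrite mxE sumr_ge0 // => i _; rewrite mxE -expr2 sqr_ge0. Qed.

Lemma quad_self_eq0 (R : realDomainType) n (u : 'rV[R]_n) :
  (u *m u^T) 0 0 = 0 -> u = 0.
Proof.
rewrite mxE => /eqP; rewrite psumr_eq0 => [/allP u0|i _]; last first.
  by rewrite mxE -expr2 sqr_ge0.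
apply/rowP => i; rewrite mxE; apply/eqP.
by have := u0 i (mem_index_enum _); rewrite !mxE -expr2 sqrf_eq0.
Qed.

(* The last clause says that every nonzero eigenvalue is at least [lambda_k]:
   [M^3 - lambda_k M^2] is positive semidefinite. *)
Lemma psd_eigen_gap (R : realType) n k (M : 'M[R]_n) :
  M^T = M -> (forall z : 'rV_n, 0 <= (z *m M *m z^T) 0 0) ->
  (k.-1 <= n - \rank M)%N -> lambda_k k M != 0 ->
  [/\ 0 < lambda_k k M, (n - \rank M)%N = k.-1
    & forall z : 'rV_n,
      lambda_k k M * (z *m M ^+ 2 *m z^T) 0 0 <= (z *m M ^+ 3 *m z^T) 0 0].
Proof.
move=> Msym Mpsd rk_le lam_neq0.
have [e [charM rankM quadM]] := sym_spectral _ _ _ Msym.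
have e_ge0 i : 0 <= e 0 i.
  have : eigenvalue M (e 0 i).
    rewrite eigenvalue_root_char charM /root horner_prod.
    by rewrite (bigD1 i) //= !hornerE subrr mul0r.
  move=> /eigenvalueP[v vM v_neq0].
  have := Mpsd v; rewrite vM -scalemxAl mxE pmulr_lge0 //.
  rewrite lt_neqAle quad_self_ge0 andbT.
  by apply: contra v_neq0 => /eqP/esym/quad_self_eq0->.
have [] := sym_eigvalsP _ _ _ Msym.
move: lam_neq0; rewrite /lambda_k; set s := eigvals M => lam_neq0 s_sorted charMs.
have perm_s : perm_eq s [seq e 0 i | i <- enum 'I_n].
  by apply: prod_XsubC_eq; rewrite -charMs charM big_map big_enum.
have s_ge0 c : c \in s -> 0 <= c.
  by rewrite (perm_mem perm_s) => /mapP[i _ ->].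
(* All eigenvalues are nonnegative, so those [<= 0] are the zeros, and their number is the
   corank. *)
have null_s : (count (<= 0) s)%O = (n - \rank M)%N.
  rewrite (permP perm_s) count_map -sum1_count big_enum_cond /=.
  rewrite big_mkcond /= rankM.
  rewrite -[X in (X - _)%N](card_ord n) -sum1_card.
  rewrite -sumnB => [|i _]; last by case: (_ != _).
  apply: eq_bigr => i _; rewrite le_eqVlt ltNge e_ge0 orbF.
  by case: (e 0 i == 0).
(* Past the end of [s], [nth] would return the default [0], which [lam_neq0] excludes. *)
have k_size : (k.-1 < size s)%N.
  by rewrite ltnNge; apply: contra lam_neq0 => ?; rewrite nth_default.
have lam_gt0 : 0 < s`_k.-1 by rewrite lt_neqAle eq_sym lam_neq0 s_ge0 ?mem_nth.
(* With more than [k.-1] zeros, the entry of index [k.-1] in the sorted list would be one of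
   them. *)
have null_k : (n - \rank M)%N = k.-1.
  apply/eqP; rewrite eqn_leq rk_le andbT leqNgt -null_s.
  by apply: contraL lam_gt0 => ?; rewrite -leNgt nth_count_le.
split=> // z; have [y y_ge0 qE] := quadM z.
rewrite !qE mulr_sumr; apply: ler_sum => i _.
rewrite mulrA ler_wpM2r //.
have [->|ei_neq0] := eqVneq (e 0 i) 0; first by rewrite !exprS !mul0r mulr0.
rewrite [leRHS]exprS ler_wpM2r ?exprn_ge0 //.
have ei_s : e 0 i \in s by rewrite (perm_mem perm_s) map_f // mem_enum.
rewrite -(nth_index 0 ei_s).
apply: le_sorted_leq_nth => //; rewrite ?inE ?index_mem //.
(* The zeros fill the first [k.-1] positions, so a nonzero eigenvalue has index at least [k.-1]. *)
rewrite leqNgt -null_k -null_s; apply: contra ei_neq0 => lt_idx.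
by rewrite eq_le e_ge0 andbT -(nth_index 0 ei_s) nth_count_le.
Qed.

(** The kernel and the row space of a symmetric matrix are orthogonal, hence meet trivially, and
    their dimensions add up to [n]. *)
Lemma sym_decomp (R : realFieldType) n (M : 'M[R]_n) (z : 'rV_n) : M^T = M ->
  exists w x : 'rV_n, z = w + x *m M /\ w *m M = 0.
Proof.
move=> Msym.
have capM : (kermx M :&: M)%MS = 0.
  apply/eqP; rewrite -submx0; apply/row_subP => i.
  have := row_sub i (kermx M :&: M)%MS; set u := row _ _.
  rewrite sub_capmx => /andP[/sub_kermxP uM /submxP[x ux]].
  suff -> : u = 0 by apply: sub0mx.
  by apply: quad_self_eq0; rewrite {2}ux trmx_mul Msym mulmxA uM mul0mx mxE.
have full : row_full (kermx M + M)%MS.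
  rewrite /row_full mxrank_disjoint_sum // mxrank_ker subnK //.
  exact: rank_leq_row.
have /sub_addsmxP[[a x] /= zE] := submx_full z full.
by exists (a *m kermx M), x; split=> //; rewrite -mulmxA mulmx_ker mulmx0.
Qed.

(** The rows of [W] lie in the kernel and, by dimension, span it. Removing the kernel part of [z]
    leaves [u = x *m M], and the two sides become the forms of [M ^+ 2] and [M ^+ 3] at [x]. *)
Lemma spectral_gap_bound (R : realType) n k p (M : 'M[R]_n) (W : 'M[R]_(p, n)) :
  M^T = M -> (forall z : 'rV_n, 0 <= (z *m M *m z^T) 0 0) ->
  W *m M = 0 -> \rank W = k.-1 -> lambda_k k M != 0 ->
  0 < lambda_k k M /\
  forall z : 'rV_n, exists c : 'rV_p, let u := z - c *m W in
    lambda_k k M * (u *m u^T) 0 0 <= (z *m M *m z^T) 0 0.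
Proof.
move=> Msym Mpsd WM0 rkW lam_neq0.
have Wker : (W <= kermx M)%MS by apply/sub_kermxP.
have rk_le : (k.-1 <= n - \rank M)%N by rewrite -rkW -mxrank_ker mxrankS.
have [lam_gt0 null_k gap] := psd_eigen_gap _ _ _ _ Msym Mpsd rk_le lam_neq0.
split=> // z; have [w [x [-> wM]]] := sym_decomp _ _ _ z Msym.
have kerW : (kermx M <= W)%MS.
  by rewrite -(mxrank_leqif_sup Wker) mxrank_ker rkW null_k.
have /submxP[c wE] : (w <= W)%MS by apply: submx_trans kerW; apply/sub_kermxP.
exists c; rewrite -wE /= [w + _]addrC addrK.
have Mw : M *m w^T = 0 by rewrite -Msym -trmx_mul wM trmx0.
rewrite linearD /= trmx_mul Msym mulmxDl wM addr0 mulmxDr.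
rewrite -[_ *m M *m M *m w^T]mulmxA Mw mulmx0 addr0.
have := gap x; rewrite -[M ^+ 2]/(M *m M) -[M ^+ 3]/(M *m (M *m M)).
by rewrite !mulmxA.
Qed.

(** Cauchy-Schwarz against the all-ones vector, through Lagrange's identity for the sum of all
    [(a i - a j) ^+ 2]. *)
Lemma sqr_sum_le (R : realDomainType) k (a : 'I_k -> R) :
  (\sum_i a i) ^+ 2 <= k%:R * \sum_i a i ^+ 2.
Proof.
have : 0 <= \sum_i \sum_j (a i - a j) ^+ 2.
  by apply: sumr_ge0 => i _; apply: sumr_ge0 => j _; apply: sqr_ge0.
have -> : \sum_i \sum_j (a i - a j) ^+ 2 =
    2 * (k%:R * \sum_i a i ^+ 2 - (\sum_i a i) ^+ 2).
  set S1 := \sum_i a i; set S2 := \sum_i a i ^+ 2.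
  transitivity (\sum_i (k%:R * a i ^+ 2 + S2 - 2 * S1 * a i)).
    apply: eq_bigr => i _; transitivity (\sum_j (a i ^+ 2 + a j ^+ 2 - 2 * a i * a j)).
      by apply: eq_bigr => j _; ring.
    rewrite sumrB big_split /= sumr_const card_ord -mulr_sumr -/S1 -/S2 -mulr_natl.
    by ring.
  rewrite sumrB big_split /= sumr_const card_ord -!mulr_sumr -/S1 -/S2 -mulr_natl.
  by ring.
by rewrite pmulr_rge0 // subr_ge0.
Qed.

Lemma mulmx_diagV (F : fieldType) n (d : 'I_n -> F) : (forall i, d i != 0) ->
  diag_mx (\row_i (d i)^-1) *m diag_mx (\row_i d i) = 1%:M.
Proof.
move=> d_neq0; rewrite mulmx_diag -diag_const_mx; congr diag_mx.
by apply/rowP => i; rewrite !mxE mulVf.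
Qed.

(** * The Gram matrix [KP] and its quadratic form *)

Section BlockMatrix.
Variables (R : realType) (k : nat) (r : 'I_k -> nat).
Implicit Types (P Q : pspace r -> R) (x : pspace r).
Local Notation N := (\sum_(i < k) r i)%N.
Local Notation Rank := (@tagnat.Rank k r).
Local Notation sig1 := (@tagnat.sig1 k r).
Local Notation sig2 := (@tagnat.sig2 k r).

Definition cell (s : 'I_N) x : R := (x (sig1 s) == sig2 s)%:R.

(** In block [i], the only index whose [cell] is nonzero at [x] is [Rank i (x i)]. *)
Lemma sum_cell (F : 'I_N -> R) x :
  \sum_s F s * cell s x = \sum_i F (Rank i (x i)).
Proof.
rewrite (partition_big sig1 predT) //=; apply: eq_bigr => i _.
rewrite (bigD1 (Rank i (x i))) ?tagnat.Rank1K //= big1 ?addr0.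
  rewrite /cell; set s := Rank i (x i).
  suff -> : x (sig1 s) == sig2 s by rewrite mulr1.
  by rewrite tagnat.Rank2K; case: _ / (esym _); rewrite cast_ord_id.
move=> s /andP[/eqP <- sN]; rewrite /cell; case: eqP => [E|]; last by rewrite mulr0.
by rewrite E tagnat.sig2K eqxx in sN.
Qed.

(** Distinct values of one coordinate are disjoint events, so diagonal blocks obey the same formula
    as joint ones. *)
Lemma KblockE P i j (a : 'I_(r i)) (b : 'I_(r j)) :
  Kblock P i j a b = \sum_x P x * ((x i == a)%:R * (x j == b)%:R).
Proof.
rewrite mxE; have [ij|_] := eqVneq i j; last first.
  rewrite /joint big_mkcond; apply: eq_bigr => x _.
  by do 2!case: eqP => _; rewrite /= ?mulr1 ?mulr0.
case: _ / ij b => b; rewrite val_eqE; have [<-|ab] := eqVneq a b.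
  rewrite /marg big_mkcond; apply: eq_bigr => x _.
  by case: eqP => _; rewrite /= ?mulr1 ?mulr0.
rewrite big1 // => x _; case: eqP => [->|_]; last by rewrite mul0r mulr0.
by rewrite (negPf ab) !mulr0.
Qed.

Lemma KPE P s t : KP P s t = \sum_x P x * (cell s x * cell t x).
Proof. by rewrite /KP mxE KblockE. Qed.

Lemma KP_diag P s : KP P s s = marg P (sig2 s).
Proof. by rewrite /KP !mxE !eqxx. Qed.

Lemma KP_sym P : (KP P)^T = KP P.
Proof.
apply/matrixP => s t; rewrite mxE !KPE; apply: eq_bigr => x _.
by rewrite [cell t x * _]mulrC.
Qed.

Definition linform (v : 'I_N -> R) x : R := \sum_i v (Rank i (x i)).

Lemma linformE v x : linform v x = \sum_s v s * cell s x.
Proof. by rewrite sum_cell. Qed.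

Lemma quadf_KP P (v : 'cV[R]_N) :
  quadf (KP P) v = expect P (fun x => linform (v^~ 0) x ^+ 2).
Proof.
rewrite /quadf /expect mxE.
under eq_bigr => t _ do rewrite mxE mulr_suml.
under eq_bigr => t _ do under eq_bigr => s _ do
  rewrite mxE KPE mulr_sumr mulr_suml.
under eq_bigr => t _ do rewrite exchange_big.
rewrite exchange_big; apply: eq_bigr => x _ /=.
rewrite expr2 linformE mulr_suml mulr_sumr exchange_big /=.
apply: eq_bigr => s _; rewrite mulr_sumr mulr_sumr; apply: eq_bigr => t _; ring.
Qed.

Lemma quadf_KP_ge0 P (v : 'cV[R]_N) : (forall x, 0 <= P x) -> 0 <= quadf (KP P) v.
Proof.
move=> P_ge0; rewrite quadf_KP; apply: sumr_ge0 => x _.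
by rewrite mulr_ge0 ?sqr_ge0.
Qed.

(** Cauchy-Schwarz applies pointwise to the [k] terms of [linform]; since [cell] is idempotent, the
    diagonal sum is the expected sum of their squares. *)
Lemma quadf_KP_le_diag Q (v : 'cV[R]_N) : (forall x, 0 <= Q x) ->
  quadf (KP Q) v <= k%:R * \sum_s KP Q s s * v s 0 ^+ 2.
Proof.
move=> Q_ge0; have -> : \sum_s KP Q s s * v s 0 ^+ 2 =
    expect Q (fun x => \sum_i v (Rank i (x i)) 0 ^+ 2).
  under eq_bigr => s _ do rewrite KPE mulr_suml.
  rewrite exchange_big; apply: eq_bigr => x _ /=.
  rewrite -(sum_cell (fun s => v s 0 ^+ 2)) mulr_sumr; apply: eq_bigr => s _.
  by rewrite -mulrA [_ * _ ^+ 2]mulrC /cell -natrM mulnb andbb.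
rewrite quadf_KP /expect mulr_sumr; apply: ler_sum => x _.
by rewrite [leRHS]mulrCA ler_wpM2l ?sqr_sum_le.
Qed.

(* Its rows span the block-constant vectors whose block constants sum to [0],
   i.e. the nontrivial decompositions of the zero function. *)
Definition nullmx : 'M[R]_(k, N) :=
  kermx (const_mx 1 : 'cV[R]_k) *m \matrix_(i < k, s < N) (sig1 s == i)%:R.

Lemma nullmxE (i : 'I_k) s :
  nullmx i s = kermx (const_mx 1 : 'cV[R]_k) i (sig1 s).
Proof.
rewrite mxE (bigD1 (sig1 s)) //= mxE eqxx mulr1 big1 ?addr0 // => j jN.
by rewrite mxE eq_sym (negPf jN) mulr0.
Qed.

Lemma linform_nullmx (i : 'I_k) x : linform (nullmx i) x = 0.
Proof.
have := mulmx_ker (const_mx 1 : 'cV[R]_k) => /matrixP/(_ i 0).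
rewrite !mxE => kerE; rewrite -[RHS]kerE; apply: eq_bigr => j _.
by rewrite nullmxE tagnat.Rank1K [X in _ * X]mxE mulr1.
Qed.

Lemma nullmx_KP P : nullmx *m KP P = 0.
Proof.
apply/matrixP => i t; rewrite !mxE.
under eq_bigr => s _ do rewrite KPE mulr_sumr.
rewrite exchange_big big1 //= => x _.
transitivity (linform (nullmx i) x * (P x * cell t x)).
  by rewrite linformE mulr_suml; apply: eq_bigr => s _; ring.
by rewrite linform_nullmx mul0r.
Qed.

(** Total mass [1] yields a point [x0], so no block is empty and the block-indicator factor
    preserves the rank [k.-1] of the kernel of the all-ones column. *)
Lemma rank_nullmx P : (0 < k)%N -> \sum_x P x = 1 -> \rank nullmx = k.-1.
Proof.
move=> k_gt0 P1; have [x0 _|P0] := pickP (@predT (pspace r)); last first.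
  by move: P1; rewrite big_pred0 => // /eqP; rewrite eq_sym oner_eq0.
rewrite mxrankMfree.
  rewrite mxrank_ker -subn1; congr (_ - _)%N.
  apply/eqP; rewrite eqn_leq rank_leq_col lt0n mxrank_eq0.
  by apply/eqP => /matrixP/(_ (Ordinal k_gt0) 0)/eqP; rewrite !mxE oner_eq0.
apply/row_freeP; exists (\matrix_(s, j) (s == Rank j (x0 j))%:R).
apply/matrixP => i j; rewrite !mxE (bigD1 (Rank j (x0 j))) //= !mxE.
rewrite tagnat.Rank1K eqxx mulr1 big1 ?addr0 => [|s sN]; first by rewrite eq_sym.
by rewrite !mxE (negPf sN) mulr0.
Qed.

(** Decompositions of the zero function are null for every weight on [pspace], so a shift chosen
    from [P] is invisible to [Q]. *)
Lemma quadf_KP_shift Q (v : 'cV[R]_N) (c : 'rV[R]_k) :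
  quadf (KP Q) (v - (c *m nullmx)^T) = quadf (KP Q) v.
Proof.
have KN : KP Q *m (c *m nullmx)^T = 0.
  by rewrite -KP_sym -trmx_mul -mulmxA nullmx_KP mulmx0 trmx0.
rewrite /quadf mulmxBr -[_ *m _ *m (_ *m _)^T]mulmxA KN mulmx0 subr0 linearB /= trmxK.
by rewrite mulmxBl -[c *m _ *m _]mulmxA nullmx_KP mulmx0 subr0.
Qed.

(** * The spectral bound *)

Definition max_ratio P Q : R :=
  \big[Num.max/0]_(i < k) \big[Num.max/0]_(t < r i) (marg Q t / marg P t).

Lemma marg_le_max_ratio P Q i (t : 'I_(r i)) : 0 < marg P t ->
  marg Q t <= max_ratio P Q * marg P t.
Proof.
move=> Pt; rewrite -ler_pdivrMr // /max_ratio.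
apply: le_trans (le_bigmax _ _ i).
exact: (le_bigmax _ (fun t : 'I_(r i) => marg Q t / marg P t) t).
Qed.

Section Bound.
Variables P Q : pspace r -> R.
Hypotheses (k_gt0 : (0 < k)%N) (P_distr : is_distr P) (Q_ge0 : forall x, 0 <= Q x).
Hypothesis P_marg : forall i (t : 'I_(r i)), 0 < marg P t.
Local Notation K := (KP P).
Local Notation lam := (lambda_k k (normK K)).

Let D : 'M[R]_N := diag_mx (\row_s (Num.sqrt (K s s))^-1).
Let D' : 'M[R]_N := diag_mx (\row_s Num.sqrt (K s s)).

Let K_gt0 s : 0 < K s s. Proof. by rewrite KP_diag. Qed.

Let DD' : D *m D' = 1%:M.
Proof.
by apply: mulmx_diagV => s; rewrite gt_eqF // sqrtr_gt0.
Qed.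

Let D'D : D' *m D = 1%:M. Proof. exact: mulmx1C. Qed.

Lemma quadf_le_spectral (v : 'cV[R]_N) : lam != 0 ->
  0 < lam /\ quadf (KP Q) v <= k%:R / lam * max_ratio P Q * quadf (KP P) v.
Proof.
move=> lam_neq0.
have DT : D^T = D by rewrite tr_diag_mx.
have D'T : D'^T = D' by rewrite tr_diag_mx.
have nE : normK K = D *m K *m D by [].
have nK_sym : (normK K)^T = normK K by rewrite nE !trmx_mul DT KP_sym mulmxA.
have qE (z : 'rV_N) : (z *m normK K *m z^T) 0 0 = quadf K (z *m D)^T.
  by rewrite nE /quadf trmxK trmx_mul DT !mulmxA.
have nK_psd (z : 'rV_N) : 0 <= (z *m normK K *m z^T) 0 0.
  by rewrite qE quadf_KP_ge0 //; case: P_distr.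
have WK : nullmx *m D' *m normK K = 0.
  by rewrite nE !mulmxA -[_ *m D' *m D]mulmxA D'D mulmx1 nullmx_KP mul0mx.
have D'_free : row_free D' by apply/row_freeP; exists D.
have rkW : \rank (nullmx *m D') = k.-1.
  by rewrite mxrankMfree // (rank_nullmx P) //; case: P_distr.
have [lam_gt0 gap] := spectral_gap_bound _ _ _ _ _ _ nK_sym nK_psd WK rkW lam_neq0.
(* At [z = v^T *m D'] the normalized form equals that of [K] at [v]; multiplying [u] by [D] turns
   the correction into a combination of rows of [nullmx]. *)
split=> //; have [c] := gap (v^T *m D'); set u := _ - _ => /= gap_u.
have uD : u *m D = (v - (c *m nullmx)^T)^T.
  by rewrite mulmxBl !mulmxA -![_ *m D' *m D]mulmxA D'D !mulmx1 [RHS]linearB /= trmxK.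
rewrite qE -mulmxA D'D mulmx1 trmxK in gap_u.
rewrite -(quadf_KP_shift Q v c) -[v - _]trmxK -uD.
apply: le_trans (quadf_KP_le_diag _ _ Q_ge0) _.
have -> : k%:R / lam * max_ratio P Q * quadf K v =
   k%:R * (max_ratio P Q * (quadf K v / lam)) by ring.
rewrite ler_wpM2l //.
have max_ge0 : 0 <= max_ratio P Q by apply: bigmax_ge_id.
apply: (@le_trans _ _ (max_ratio P Q * (u *m u^T) 0 0)); last first.
  by rewrite ler_wpM2l // ler_pdivlMr // mulrC.
have uDE s : (u *m D)^T s 0 = u 0 s / Num.sqrt (K s s).
  by rewrite [LHS]mxE mul_mx_diag [LHS]mxE; congr (_ * _); rewrite mxE.
(* Both sides are now diagonal sums; squaring the entries of [D] gives [1 / marg P], so the ratio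
   bound applies termwise. *)
rewrite mxE mulr_sumr; apply: ler_sum => s _.
rewrite uDE exprMn exprVn (sqr_sqrtr (ltW (K_gt0 s))) !KP_diag [u^T s 0]mxE.
rewrite -expr2 [leLHS]mulrCA [leRHS]mulrC ler_wpM2l ?sqr_ge0 //.
by rewrite ler_pdivrMr // marg_le_max_ratio.
Qed.

End Bound.

Lemma sub_addfun (f g : forall i, 'I_(r i) -> R) x :
  addfun f x - addfun g x =
  linform (fun s => f (sig1 s) (sig2 s) - g (sig1 s) (sig2 s)) x.
Proof.
rewrite /addfun -sumrB; apply: eq_bigr => i _.
by rewrite tagnat.Rank2K; case: _ / (esym _); rewrite cast_ord_id.
Qed.

Lemma tauE P Q : tau P Q =
  ereal_sup [set ratioE (quadf (KP Q) v) (quadf (KP P) v) | v in [set: 'cV[R]_N]].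
Proof.
have expectE (P' : pspace r -> R) f g :
    expect P' (fun x => (addfun f x - addfun g x) ^+ 2) =
    quadf (KP P') (\col_s (f (sig1 s) (sig2 s) - g (sig1 s) (sig2 s))).
  rewrite quadf_KP; apply: eq_bigr => x _; rewrite sub_addfun.
  by congr (_ * _ ^+ 2); apply: eq_bigr => i _; rewrite mxE.
congr ereal_sup; apply/seteqP; split=> [y [f [g ->]]|y [v _ <-]] /=.
  by rewrite !expectE; eexists.
(* Differences of additive functions are additive, so [g = 0] already realizes every [v]. *)
exists (fun i t => v (Rank i t) 0), (fun i t => 0).
rewrite !expectE; congr ratioE; congr quadf.
all: by apply/colP => s; rewrite mxE tagnat.sig2K subr0.
Qed.

End BlockMatrix.

(** When [b = 0] the inequality forces [a = 0], so the infinite branch of [ratioE] is never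
    reached. *)
Lemma ratioE_le (R : realType) (a b C : R) :
  0 <= a -> 0 <= b -> 0 <= C -> a <= C * b -> (ratioE a b <= C%:E)%E.
Proof.
move=> a_ge0 b_ge0 C_ge0 aCb; rewrite /ratioE; have [b0|b_neq0] := eqVneq b 0.
  have -> : a = 0 by apply/eqP; rewrite eq_le a_ge0 andbT -(mulr0 C) -b0.
  by rewrite eqxx lee_fin.
by rewrite lee_fin ler_pdivrMr // lt_neqAle eq_sym b_neq0.
Qed.

Theorem mainTheorem3 (R : realType) (k : nat) (r : 'I_k -> nat)
  (P Q : pspace r -> R) :
  (2 <= k)%N ->
  is_distr P -> is_distr Q ->
  (forall (i : 'I_k) (t : 'I_(r i)), 0 < marg P t) ->
  tau P Q = ereal_sup [set ratioE (quadf (KP Q) v) (quadf (KP P) v) | v in [set: 'cV[R]_(\sum_(i < k) r i)]]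
  /\
  (tau P Q <=
     (let lam := lambda_k k (normK (KP P)) in
      let M := (\big[Num.max/0]_(i < k) \big[Num.max/0]_(t < r i) (marg Q t / marg P t))%R in
      if (lam == 0)%R then +oo else (k%:R / lam * M)%R%:E))%E.
Proof.
move=> k_ge2 P_distr [Q_ge0 _] P_marg; split; first exact: tauE.
rewrite tauE /=; case: eqVneq => [_|lam_neq0]; first by rewrite leey.
have k_gt0 : (0 < k)%N by apply: ltnW.
apply: ge_ereal_sup => _ [v _ <-].
have [lam_gt0 v_le] := quadf_le_spectral _ _ _ _ _ k_gt0 P_distr Q_ge0 P_marg v lam_neq0.
apply: ratioE_le => //; try by apply: quadf_KP_ge0; case: P_distr.
by rewrite mulr_ge0 ?divr_ge0 ?(ltW lam_gt0) // bigmax_ge_id.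
Qed.
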